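(* Let $A\in\mathbb{R}^{p\times n}$, $B\in\mathbb{R}^{p\times m}$, $c\in\mathbb{R}^p$, and let $f:\mathbb{R}^n\to\mathbb{R}\cup\{+\infty\}$ and $g:\mathbb{R}^m\to\mathbb{R}\cup\{+\infty\}$ be closed, proper, convex functions. Assume that the Lagrangian $L_0(x,z,\lambda)=f(x)+g(z)+\lambda^\top(Ax+Bz-c)$ has a saddle point $(x^\star,z^\star,\lambda^\star)$, i.e. $L_0(x^\star,z^\star,\lambda)\le L_0(x^\star,z^\star,\lambda^\star)\le L_0(x,z,\lambda^\star)$ for all $(x,z,\lambda)\in\mathbb{R}^n\times\mathbb{R}^m\times\mathbb{R}^p$, and put $p^\star:=f(x^\star)+g(z^\star)$. Let $\{R_k\}_{k\ge0}$ and $\{\Gamma_k\}_{k\ge0}$ be sequences of positive definite diagonal $p\times p$ matrices such that for all $k$ $$\rho_{\min}I\preceq R_k\preceq\rho_{\max}I,\qquad \alpha_{\min}I\preceq\Gamma_k\preceq\alpha_{\max}I,$$ where $0<\rho_{\min}\le\rho_{\max}<\infty$ and $0<\alpha_{\min}\le\alpha_{\max}<2$. Assume there exist nonnegative sequences $\{\underline{\eta}_k\},\{\overline{\eta}_k\},\{\underline{\xi}_k\},\{\overline{\xi}_k\}$ with $\underline{\eta}_k<1$ and $\underline{\xi}_k<1$ for all $k$, such that for all $k$ $$(1-\underline{\eta}_k)R_k\preceq R_{k+1}\preceq(1+\overline{\eta}_k)R_k,\qquad (1-\underline{\xi}_k)\Gamma_k\preceq\Gamma_{k+1}\preceq(1+\overline{\xi}_k)\Gamma_k,$$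 and such that, with $\theta_k^R:=\max\{\underline{\eta}_k/(1-\underline{\eta}_k),\,\overline{\eta}_k\}$ and $\theta_k^\Gamma:=\max\{\underline{\xi}_k/(1-\underline{\xi}_k),\,\overline{\xi}_k\}$, one has $\sum_{k=0}^\infty(\theta_k^R+\theta_k^\Gamma)<\infty$. Let $z_0\in\mathbb{R}^m$, $\lambda_0\in\mathbb{R}^p$ be given and let $\{x_k,z_k,\lambda_k\}$ be generated, for $k\ge0$, by the matrix-valued relaxed ADMM iteration $$x_{k+1}\in\arg\min_x\; f(x)+\tfrac12\|Ax+Bz_k-c+R_k^{-1}\lambda_k\|_{R_k}^2,$$ $$\tilde x_{k+1}:=\Gamma_kAx_{k+1}-(I-\Gamma_k)(Bz_k-c),$$ $$z_{k+1}\in\arg\min_z\; g(z)+\tfrac12\|\tilde x_{k+1}+Bz-c+R_k^{-1}\lambda_k\|_{R_k}^2,$$ $$\lambda_{k+1}:=\lambda_k+R_k(\tilde x_{k+1}+Bz_{k+1}-c),$$ where it is assumed that for every $k$ both minimization problems admit at least one minimizer (in $\mathbb{R}^n$ and $\mathbb{R}^m$ respectively). Then: 1. the primal residual $r_{k+1}:=Ax_{k+1}+Bz_{k+1}-c$ satisfies $\lim_{k\to\infty}r_{k+1}=0$; 2. the dual residual $s_{k+1}:=A^\top R_kB(z_{k+1}-z_k)$ satisfies $\lim_{k\to\infty}s_{k+1}=0$; 3. the objective values $p_k:=f(x_k)+g(z_k)$ satisfy $\lim_{k\to\infty}p_k=p^\star$.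
   Context: For a symmetric positive definite matrix $M$, $\|v\|_M^2:=v^\top Mv$. For symmetric matrices, $M\preceq N$ means $N-M$ is positive semidefinite. The underlying optimization problem is $\min_{x,z} f(x)+g(z)$ subject to $Ax+Bz=c$. The minimizers in the $x$- and $z$-updates need not be unique; the claim concerns any sequence generated by the iteration with any choice of minimizers. *)

(* Defs.v *)
From HB Require Import structures.
From mathcomp Require Export all_boot all_order all_algebra.
From mathcomp Require Export all_classical all_reals all_analysis.
Export Order.TTheory GRing.Theory Num.Theory.
Export numFieldNormedType.Exports.

Set Implicit Arguments.
Unset Strict Implicit.
Unset Printing Implicit Defensive.

Local Open Scope classical_set_scope.
Local Open Scope ring_scope.

Definition dotv (R : realType) (n : nat) (u v : 'cV[R]_n) : R :=
  (u^T *m v) ord0 ord0.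

Definition wnorm2 (R : realType) (n : nat) (M : 'M[R]_n) (v : 'cV[R]_n) : R :=
  (v^T *m M *m v) ord0 ord0.

Definition psdmx (R : realType) (n : nat) (M : 'M[R]_n) : Prop :=
  M^T = M /\ forall v : 'cV[R]_n, 0 <= wnorm2 M v.

Definition pdmx (R : realType) (n : nat) (M : 'M[R]_n) : Prop :=
  M^T = M /\ forall v : 'cV[R]_n, v != 0 -> 0 < wnorm2 M v.

Definition loewner_le (R : realType) (n : nat) (M N : 'M[R]_n) : Prop :=
  psdmx (N - M).

(* A function into the reals with +oo adjoined is encoded as a function into
   \bar R; the exclusion of the value -oo is part of [proper_fun]. *)
Definition proper_fun (R : realType) (T : Type) (f : T -> \bar R) : Prop :=
  (forall x, f x != -oo%E) /\ (exists x, (f x < +oo)%E).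

Definition epigraph (R : realType) (T : Type) (f : T -> \bar R) : set (T * R) :=
  [set xt | (f xt.1 <= xt.2%:E)%E].

Definition closed_fun (R : realType) (n : nat) (f : 'cV[R]_n -> \bar R) : Prop :=
  closed (epigraph f).

(* Intended for f that avoids -oo; the endpoints t = 0 and t = 1 are harmless
   because 0 * +oo = 0 in \bar R. *)
Definition convex_fun (R : realType) (n : nat) (f : 'cV[R]_n -> \bar R) : Prop :=
  forall (x y : 'cV[R]_n) (t : R), 0 <= t <= 1 ->
    (f (t *: x + (1 - t) *: y)%R <= t%:E * f x + (1 - t)%:E * f y)%E.

Definition closed_proper_convex (R : realType) (n : nat)
    (f : 'cV[R]_n -> \bar R) : Prop :=
  [/\ closed_fun f, proper_fun f & convex_fun f].

Definition argmin (R : realType) (T : Type) (F : T -> \bar R) : set T :=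
  [set x | forall y, (F x <= F y)%E].

Definition lagrangian (R : realType) (p n m : nat)
    (A : 'M[R]_(p, n)) (B : 'M[R]_(p, m)) (c : 'cV[R]_p)
    (f : 'cV[R]_n -> \bar R) (g : 'cV[R]_m -> \bar R)
    (x : 'cV[R]_n) (z : 'cV[R]_m) (lam : 'cV[R]_p) : \bar R :=
  (f x + g z + (dotv lam (A *m x + B *m z - c)%R)%:E)%E.

Definition saddle_point (R : realType) (p n m : nat)
    (A : 'M[R]_(p, n)) (B : 'M[R]_(p, m)) (c : 'cV[R]_p)
    (f : 'cV[R]_n -> \bar R) (g : 'cV[R]_m -> \bar R)
    (xs : 'cV[R]_n) (zs : 'cV[R]_m) (lams : 'cV[R]_p) : Prop :=
  let L := lagrangian A B c f g in
  forall (x : 'cV[R]_n) (z : 'cV[R]_m) (lam : 'cV[R]_p),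
    (L xs zs lam <= L xs zs lams)%E /\ (L xs zs lams <= L x z lams)%E.

Definition theta (R : realType) (lo hi : R) : R := Num.max (lo / (1 - lo)) hi.

(* One step (z, lam) -> (x', z', lam') of the iteration, with relaxed point
   xt'.  It is a relation since the minimizers need not be unique. *)
Definition radmm_step (R : realType) (p n m : nat)
    (A : 'M[R]_(p, n)) (B : 'M[R]_(p, m)) (c : 'cV[R]_p)
    (f : 'cV[R]_n -> \bar R) (g : 'cV[R]_m -> \bar R)
    (Rk Gk : 'M[R]_p) (z : 'cV[R]_m) (lam : 'cV[R]_p)
    (x' : 'cV[R]_n) (xt' : 'cV[R]_p) (z' : 'cV[R]_m) (lam' : 'cV[R]_p) : Prop :=
  [/\ argmin (fun u : 'cV[R]_n => (f u +
        (2^-1 * wnorm2 Rk (A *m u + B *m z - c + invmx Rk *m lam))%R%:E)%E) x',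
      xt' = Gk *m A *m x' - (1%:M - Gk) *m (B *m z - c),
      argmin (fun w : 'cV[R]_m => (g w +
        (2^-1 * wnorm2 Rk (xt' + B *m w - c + invmx Rk *m lam))%R%:E)%E) z' &
      lam' = lam + Rk *m (xt' + B *m z' - c)].

(* Main.v *)
(** Let [R], [G] be the diagonal matrices of a step, let [e = B (z_k - zs)],
    [l = lam_k - lams], let [q = A x_{k+1} + B z_k - c], and put [y = l - R e].
    The relaxed step reads [y + R G q] as long as [R] is kept, and optimality of the
    two minimizers against the saddle point gives [<y, q> <= - <R q, q>].  Hence
    [V = <(R G)^-1 y, y>] decreases by at least [<R (2 - G) q, q>].  Since
    [<l, e> <= 0], [V] also dominates [|e|^2] and [|l|^2], so that replacing the
    weights by the next ones costs only a factor [1 + O(theta_k)], which is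
    summable.  Thus [V] is bounded and [q] tends to 0; monotonicity of the
    subdifferential of [g] then forces [B (z_{k+1} - z_k)] to 0, and the objective
    is squeezed between the saddle point and the optimality inequalities. *)

Require Import Defs.
From mathcomp Require Import ring lra.
Set Implicit Arguments.
Unset Strict Implicit.
Unset Printing Implicit Defensive.
Local Open Scope classical_set_scope.
Local Open Scope ring_scope.

(** Passage to the limit [t -> 0] in a first-order inequality, done with a single explicit [t]. *)
Lemma le_of_forall_small_mul (R : realFieldType) (a b c : R) :
  (forall t, 0 < t <= 1 -> a <= b + t * c) -> a <= b.
Proof.
move=> h; apply: contrapT => /negP; rewrite -ltNge => ba.
(* With this [t] the error [t * c] falls short of [a - b] by at least [t * (a - b + 1)]. *)
pose t := (a - b) / (a - b + `|c| + 1).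
have c0 := normr_ge0 c.
have D0 : 0 < a - b + `|c| + 1 by lra.
have t0 : 0 < t by apply: divr_gt0; lra.
have tD : t * (a - b + `|c| + 1) = a - b by rewrite /t divfK ?gt_eqF.
have t1 : t <= 1 by rewrite ler_pdivrMr //; lra.
have tc : t * c <= t * `|c| by rewrite ler_pM2l // ler_norm.
have := h t; rewrite t0 t1 => /(_ isT) => H.
have : 0 < t * (a - b + 1) by apply: mulr_gt0 => //; lra.
nra.
Qed.

(** * Inner products, quadratic forms and diagonal matrices *)

Section dotv.
Variables (R : realType) (n : nat).
Implicit Types u v w : 'cV[R]_n.

Lemma dotvE u v : dotv u v = \sum_i u i 0 * v i 0.
Proof. by rewrite /dotv mxE; apply: eq_bigr => i _; rewrite mxE. Qed.

Lemma dotvC u v : dotv u v = dotv v u.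
Proof. by rewrite !dotvE; apply: eq_bigr => i _; rewrite mulrC. Qed.

Lemma dotvDr u v w : dotv u (v + w) = dotv u v + dotv u w.
Proof. by rewrite /dotv mulmxDr mxE. Qed.

Lemma dotvNr u v : dotv u (- v) = - dotv u v.
Proof. by rewrite /dotv mulmxN mxE. Qed.

Lemma dotvZr u (a : R) v : dotv u (a *: v) = a * dotv u v.
Proof. by rewrite /dotv -scalemxAr mxE. Qed.

Lemma dotvDl u v w : dotv (u + v) w = dotv u w + dotv v w.
Proof. by rewrite dotvC dotvDr !(dotvC w). Qed.

Lemma dotvNl u v : dotv (- u) v = - dotv u v.
Proof. by rewrite dotvC dotvNr (dotvC v). Qed.

Lemma dotvZl (a : R) u v : dotv (a *: u) v = a * dotv u v.
Proof. by rewrite dotvC dotvZr (dotvC v). Qed.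

Definition dotv_lin := (dotvDl, dotvDr, dotvNl, dotvNr, dotvZl, dotvZr).

Lemma dotv_ge0 u : 0 <= dotv u u.
Proof. by rewrite dotvE; apply: sumr_ge0 => i _; rewrite -expr2 sqr_ge0. Qed.

Lemma dotv_eq0 u : dotv u u <= 0 -> u = 0.
Proof.
move=> u0; have /eqP : dotv u u = 0 by apply/eqP; rewrite eq_le u0 dotv_ge0.
rewrite dotvE psumr_eq0; last by move=> i _; rewrite -expr2 sqr_ge0.
move=> /allP h; apply/matrixP => i j; rewrite (ord1 j) mxE.
by have := h i (mem_index_enum _); rewrite /= mulf_eq0 orbb => /eqP.
Qed.

Lemma dotv_mulmx_sym (M : 'M[R]_n) u v :
  M^T = M -> dotv u (M *m v) = dotv (M *m u) v.
Proof. by move=> sM; rewrite /dotv trmx_mul sM mulmxA. Qed.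

Lemma wnorm2E (M : 'M[R]_n) v : wnorm2 M v = dotv v (M *m v).
Proof. by rewrite /wnorm2 /dotv mulmxA. Qed.

Lemma wnorm2DZ (M : 'M[R]_n) v w (t : R) : M^T = M ->
  wnorm2 M (v + t *: w) =
  wnorm2 M v + 2 * t * dotv (M *m v) w + t ^+ 2 * wnorm2 M w.
Proof.
move=> sM; rewrite !wnorm2E mulmxDr -scalemxAr !dotv_lin.
by rewrite (dotv_mulmx_sym v w sM) (dotvC w (M *m v)); ring.
Qed.

Lemma diag_mulmxE (M : 'M[R]_n) v i :
  is_diag_mx M -> (M *m v) i 0 = M i i * v i 0.
Proof.
move=> /is_diag_mxP dM; rewrite mxE (bigD1 i) //= big1 ?addr0 // => j ji.
by rewrite dM ?mul0r // eq_sym.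
Qed.

(** The quadratic form of [N - M] at a coordinate vector is a diagonal entry. For the diagonal
    weights of the iteration this turns Loewner bounds into scalar ones. *)
Lemma loewner_le_diag (M N : 'M[R]_n) i : loewner_le M N -> M i i <= N i i.
Proof.
move=> [_ /(_ (delta_mx i 0))]; rewrite wnorm2E dotvE (bigD1 i) //= big1.
  rewrite addr0 -colE !mxE !eqxx mul1r => h; lra.
by move=> j ji; rewrite !mxE (negPf ji) mul0r.
Qed.

End dotv.

(** * First-order optimality of convex minimizers *)

Lemma proper_argmin_fin (R : realType) (T : Type) (f : T -> \bar R) (k : T -> R) x :
  proper_fun f -> argmin (fun u => f u + (k u)%:E)%E x -> f x \is a fin_num.
Proof.
move=> [fN [y fy]] /(_ y) /= h; rewrite fin_numE fN /=.
have : (f x + (k x)%:E < +oo)%E.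
  by apply: le_lt_trans h _; rewrite lte_add_pinfty ?ltry.
by case: (f x).
Qed.

(** Comparing [x] with [t *: y + (1 - t) *: x], convexity of [f] and expansion of the square give
    the claim multiplied by [t], up to a term of order [t ^+ 2]; then [t] tends to 0. Here [k] is
    affine with linear part [C]. *)
Lemma argmin_quadratic_subgradient (R : realType) (n p : nat)
    (f : 'cV[R]_n -> \bar R) (C : 'M[R]_(p, n)) (M : 'M[R]_p)
    (k : 'cV[R]_n -> 'cV[R]_p) (x y : 'cV[R]_n) :
  proper_fun f -> convex_fun f -> M^T = M ->
  (forall u v, k v - k u = C *m (v - u)) ->
  argmin (fun u => f u + (2^-1 * wnorm2 M (k u))%:E)%E x ->
  f y \is a fin_num ->
  fine (f x) <= fine (f y) + dotv (M *m k x) (C *m (y - x)).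
Proof.
move=> pf cf sM kC hx fy.
have fx := proper_argmin_fin pf hx.
set D := dotv _ _; pose Q := 2^-1 * wnorm2 M (C *m (y - x)).
apply: (@le_of_forall_small_mul _ _ _ Q) => t /andP[t0 t1].
have kt : k (t *: y + (1 - t) *: x) = k x + t *: (C *m (y - x)).
  rewrite -[LHS](subrK (k x)) kC addrC scalemxAr; congr (_ + _ *m _).
  by apply/matrixP => i j; rewrite !mxE; ring.
have h1 := cf y x t; rewrite (ltW t0) t1 in h1.
have {h1} := h1 isT; have := hx (t *: y + (1 - t) *: x).
rewrite kt (wnorm2DZ _ _ _ sM).
move: fx fy (pf.1 (t *: y + (1 - t) *: x)).
case: (f x) => // a _; case: (f y) => // b _.
case: (f _) => // r _; rewrite -!EFinM -!EFinD !lee_fin /= -/D => h2 h3.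
suff : 0 <= t * (b + D + t * Q - a) by rewrite pmulr_rge0 // subr_ge0.
rewrite /Q; nra.
Qed.

(** * Null sequences, quasi-Fejer monotonicity and change of weights *)

Lemma nneg_bounded_series_cvg0 (R : realType) (u : R^nat) (S : R) :
  (forall k, 0 <= u k) -> (forall N, \sum_(0 <= k < N) u k <= S) ->
  u @ \oo --> 0.
Proof.
move=> u0 uS; apply: cvg_series_cvg_0.
apply: nondecreasing_is_cvgn.
  by apply/nondecreasing_seqP => N; rewrite /series /= big_nat_recr //= lerDl.
by exists S => _ [N _ <-]; exact: uS.
Qed.

Lemma sqr_cvg0 (R : realType) (u v : R^nat) :
  (forall k, u k ^+ 2 <= v k) -> v @ \oo --> 0 -> u @ \oo --> 0.
Proof.
move=> uv v0; apply/cvgrPdist_lt => e e0.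
move/cvgrPdist_lt : v0 => /(_ (e ^+ 2)); rewrite exprn_gt0 // => /(_ isT).
apply: filterS => k; rewrite !sub0r !normrN => vk.
rewrite -(ltr_pXn2r (n := 2)) ?nnegrE ?(ltW e0) // real_normK ?num_real //.
by apply: le_lt_trans vk; exact: le_trans (uv k) (ler_norm _).
Qed.

Lemma bounded_mul_cvg0 (R : realType) (u v : R^nat) (C : R) :
  (forall k, `|u k| <= C) -> v @ \oo --> 0 -> (fun k => u k * v k) @ \oo --> 0.
Proof.
move=> uC v0.
apply/norm_cvg0P.
apply: (@squeeze_cvgr _ _ _ _ (fun=> 0) (fun k => C * `|v k|)).
- by apply: nearW => k; rewrite normr_ge0 normrM ler_wpM2r.
- exact: cvg_cst.
- by rewrite -[X in _ --> X](mulr0 C); apply: cvgMr; apply/norm_cvg0P.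
Qed.

(* Dividing [V k] by [expR (kap * \sum_(j < k) th j)] turns the hypothesis into
   genuine monotonicity. *)
Lemma quasi_fejer (R : realType) (V n th : R^nat) (kap S : R) :
  0 <= kap -> (forall k, 0 <= V k) -> (forall k, 0 <= n k) ->
  (forall k, 0 <= th k) -> (forall N, \sum_(0 <= k < N) th k <= S) ->
  (forall k, V k.+1 <= expR (kap * th k) * (V k - n k)) ->
  (forall k, V k <= expR (kap * S) * V 0%N) /\ n @ \oo --> 0.
Proof.
move=> k0 V0 n0 th0 thS hV.
pose T N := \sum_(0 <= k < N) th k.
pose U N := expR (- (kap * T N)) * V N.
have US N : U N.+1 <= U N - expR (- (kap * S)) * n N.
  have /(ler_wpM2l (expR_ge0 (- (kap * T N.+1)))) := hV N.
  rewrite -/(U N.+1) mulrA -expRD {1}/T big_nat_recr //= -/(T N).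
  rewrite (_ : _ + _ = - (kap * T N)); last by ring.
  rewrite mulrBr => /le_trans -> //.
  rewrite lerD2l lerN2; apply: ler_wpM2r => //.
  by rewrite ler_expR lerN2 ler_wpM2l //; exact: thS.
have e0 : 0 < expR (- (kap * S)) by exact: expR_gt0.
(* Telescoping: each step of [U] pays a fixed positive multiple of [n], which bounds the partial
   sums of [n]. *)
have UB N : U N + expR (- (kap * S)) * \sum_(0 <= k < N) n k <= V 0%N.
  elim: N => [|N IH].
    by rewrite /U /T !big_geq // !mulr0 oppr0 expR0 mul1r addr0.
  by rewrite big_nat_recr //= mulrDr; have := US N; lra.
have sn N : 0 <= \sum_(0 <= k < N) n k by apply: sumr_ge0.
split=> [k|].
  have h := UB k.
  have {h} : U k <= V 0%N.
    by have := mulr_ge0 (ltW e0) (sn k); lra.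
  rewrite /U expRN mulrC ler_pdivrMr ?expR_gt0 // => /le_trans -> //.
  by rewrite mulrC ler_wpM2r // ler_expR ler_wpM2l //; exact: thS.
apply: (@nneg_bounded_series_cvg0 _ _ ((expR (- (kap * S)))^-1 * V 0%N)) => // N.
rewrite mulrC ler_pdivlMr // mulrC.
have := UB N; have : 0 <= U N by rewrite mulr_ge0 ?expR_ge0.
lra.
Qed.

(** One coordinate of the Lyapunov function under a change of weights. The shift [(r - r') * e] is
    bounded by [t] times [r * e] in absolute value, so Young's inequality with parameter [t] costs a
    factor [1 + t]; the new weight [(r' * g')^-1] costs [(1 + t) ^+ 2]. *)
Lemma weight_change (R : realFieldType) (r g r' g' l e t : R) :
  0 < r -> 0 < g -> 0 < r' -> 0 < g' -> 0 <= t ->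
  `|r' - r| <= t * r -> r <= (1 + t) * r' -> g <= (1 + t) * g' ->
  (l - r' * e) ^+ 2 / (r' * g') <=
  (1 + t) ^+ 3 * ((l - r * e) ^+ 2 / (r * g) + t * (r * e ^+ 2 / g)).
Proof.
move=> r0 g0 r'0 g'0 t0 hr hr' hg.
have t1 : 0 <= 1 + t by lra.
have w : (r' * g')^-1 <= (1 + t) ^+ 2 * (r * g)^-1.
  rewrite -[leLHS]mul1r ler_pdivrMr ?mulr_gt0 // mulrAC ler_pdivlMr ?mulr_gt0 //.
  rewrite mul1r (_ : _ * (r' * g') = ((1 + t) * r') * ((1 + t) * g')); last by ring.
  by apply: ler_pM => //; exact: ltW.
have s : (l - r' * e) ^+ 2 <= (1 + t) * ((l - r * e) ^+ 2 + t * (r * e) ^+ 2).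
  set a := l - r * e; set b := r * e.
  have [v -> hv] : exists2 v, l - r' * e = a + v & v ^+ 2 <= (t * b) ^+ 2.
    exists ((r - r') * e); first by rewrite /a; ring.
    rewrite /b mulrA !exprMn ler_wpM2r ?sqr_ge0 //.
    rewrite -[leLHS]real_normK ?num_real // distrC -exprMn.
    by rewrite ler_pXn2r ?nnegrE // mulr_ge0 // ltW.
  (* The bound is obtained below multiplied by [t], so the case [t = 0], where [v = 0], is treated
     apart. *)
  have [tz|tp] := eqVneq t 0.
    move: hv; rewrite tz mul0r expr0n /= => hv.
    have /eqP : v ^+ 2 = 0 by apply/eqP; rewrite eq_le sqr_ge0 andbT.
    by rewrite sqrf_eq0 => /eqP ->; lra.
  have tp' : 0 < t by rewrite lt_def tp.
  have : 0 <= (t * a - v) ^+ 2 by exact: sqr_ge0.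
  move=> h.
  have h2 : 0 <= t * ((1 + t) * (a ^+ 2 + t * b ^+ 2) - (a + v) ^+ 2).
    have -> : t * ((1 + t) * (a ^+ 2 + t * b ^+ 2) - (a + v) ^+ 2) =
      (t * a - v) ^+ 2 + (1 + t) * ((t * b) ^+ 2 - v ^+ 2) by ring.
    by rewrite addr_ge0 // mulr_ge0 // subr_ge0.
  by move: h2; rewrite pmulr_rge0 // subr_ge0.
have -> : (1 + t) ^+ 3 * ((l - r * e) ^+ 2 / (r * g) + t * (r * e ^+ 2 / g)) =
  ((1 + t) * ((l - r * e) ^+ 2 + t * (r * e) ^+ 2)) * ((1 + t) ^+ 2 * (r * g)^-1).
  by field; rewrite !gt_eqF.
apply: ler_pM => //; first exact: sqr_ge0.
by rewrite invr_ge0 mulr_ge0 // ltW.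
Qed.

(** * Coordinatewise convergence of the iteration *)

Lemma mx_cvg (R : realType) (m n : nat) (u : nat -> 'M[R]_(m, n)) (M : 'M[R]_(m, n)) :
  (forall i j, (fun k => u k i j) @ \oo --> M i j) -> u @ \oo --> M.
Proof.
move=> h A [P MP sPA].
have hP : \forall k \near \oo, forall i j, P i j (u k i j).
  by apply: filter_forall => i; apply: filter_forall => j; exact: h (MP i j).
by apply: filterS hP => k; exact: sPA.
Qed.

Lemma sum_cvg0 (R : realType) (I : finType) (u : nat -> I -> R) :
  (forall i, (fun k => u k i) @ \oo --> 0) -> (fun k => \sum_i u k i) @ \oo --> 0.
Proof.
move=> h; elim: (index_enum I) => [|i s IHs].
  by under eq_fun do rewrite big_nil; exact: cvg_cst.
under eq_fun do rewrite big_cons.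
suff : (fun k => u k i + \sum_(j <- s) u k j) @ \oo --> (0 + 0 : R) by rewrite addr0.
exact: cvgD (h i) IHs.
Qed.

Lemma norm_le_sqr_bound (R : realFieldType) (a b : R) : a ^+ 2 <= b -> `|a| <= 1 + b.
Proof. by move=> ab; rewrite ler_norml; apply/andP; split; nra. Qed.

Lemma ler_sum1 (R : numDomainType) (I : finType) (u : I -> R) i :
  (forall j, 0 <= u j) -> u i <= \sum_j u j.
Proof. by move=> u0; rewrite (bigD1 i) //= lerDl sumr_ge0. Qed.

(* In coordinates relative to the saddle point, [e], [l] and [q] stand for
   B (z_k - zs), lam_k - lams and A x_{k+1} + B z_k - c. *)
Lemma relaxed_splitting_cvg (R : realType) (p : nat)
    (r g e l q : nat -> 'I_p -> R) (th : R^nat) (S rm rM am aM : R) :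
  0 < rm -> 0 < am -> am <= aM -> aM < 2 ->
  (forall k i, rm <= r k i <= rM) -> (forall k i, am <= g k i <= aM) ->
  (forall k, 0 <= th k) -> (forall N, \sum_(0 <= k < N) th k <= S) ->
  (forall k i, `|r k.+1 i - r k i| <= th k * r k i) ->
  (forall k i, r k i <= (1 + th k) * r k.+1 i) ->
  (forall k i, g k i <= (1 + th k) * g k.+1 i) ->
  (forall k i, l k.+1 i = l k i + r k i * (g k i * q k i + (e k.+1 i - e k i))) ->
  (forall k, \sum_i (l k i - r k i * e k i) * q k i <= - \sum_i r k i * q k i ^+ 2) ->
  (forall k, \sum_i l k i * e k i <= 0) ->
  (forall k, \sum_i (l k.+1 i - l k i) * (e k.+1 i - e k i) <= 0) ->
  [/\ forall i, (fun k => q k i) @ \oo --> 0,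
      forall i, (fun k => e k.+1 i - e k i) @ \oo --> 0 &
      exists C, forall k i, `|e k i| <= C /\ `|l k i| <= C].
Proof.
move=> rm0 am0 amM aM2 hr hg th0 thS hrv hr' hg' hl hq hle hmon.
have r0 k i : 0 < r k i by have /andP[h _] := hr k i; exact: lt_le_trans h.
have g0 k i : 0 < g k i by have /andP[h _] := hg k i; exact: lt_le_trans h.
have aM0 : 0 < aM by exact: lt_le_trans amM.
pose V k := \sum_i (l k i - r k i * e k i) ^+ 2 / (r k i * g k i).
(* [W] is the Lyapunov function at the new point with the old weights; only the passage from [W k]
   to [V k.+1] sees the variation of [r] and [g]. *)
pose W k := \sum_i (l k.+1 i - r k i * e k.+1 i) ^+ 2 / (r k i * g k i).
pose n k := (2 - aM) * \sum_i r k i * q k i ^+ 2.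
have V0 k : 0 <= V k.
  by apply: sumr_ge0 => i _; rewrite divr_ge0 ?sqr_ge0 // mulr_ge0 // ltW.
have n0 k : 0 <= n k.
  apply: mulr_ge0; first by rewrite subr_ge0 ltW.
  apply: sumr_ge0 => i _.
  by rewrite mulr_ge0 ?sqr_ge0 // ltW.
have WV k : W k <= V k - n k.
  (* By [hl], [y = l - r * e] becomes [y + r * g * q], and division by [r * g] makes the cross term
     exactly [2 * y * q], which [hq] bounds. *)
  have -> : W k = V k + 2 * (\sum_i (l k i - r k i * e k i) * q k i)
                 + \sum_i r k i * g k i * q k i ^+ 2.
    rewrite /W /V mulr_sumr -!big_split /=; apply: eq_bigr => i _.
    by rewrite hl; field; rewrite !gt_eqF.
  have : \sum_i r k i * g k i * q k i ^+ 2 <= aM * \sum_i r k i * q k i ^+ 2.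
    rewrite mulr_sumr; apply: ler_sum => i _.
    rewrite mulrA ler_wpM2r ?sqr_ge0 // mulrC ler_wpM2r ?(ltW (r0 k i)) //.
    by have /andP[] := hg k i.
  by have := hq k; rewrite /n; lra.
(* [r] being fixed here, the cross term of the square is [- 2 * \sum_i l i * e i],
   so the Lyapunov function controls both [e] and [l]. *)
have coer (rr ll ee gg : 'I_p -> R) : (forall i, 0 < rr i) ->
    (forall i, 0 < gg i) -> (forall i, gg i <= aM) -> \sum_i ll i * ee i <= 0 ->
    \sum_i (ll i ^+ 2 / rr i + rr i * ee i ^+ 2) <=
    aM * \sum_i (ll i - rr i * ee i) ^+ 2 / (rr i * gg i).
  move=> rr0 gg0 ggM hs.
  apply: (@le_trans _ _ (\sum_i (ll i - rr i * ee i) ^+ 2 / rr i)).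
    have -> : \sum_i (ll i - rr i * ee i) ^+ 2 / rr i =
        \sum_i (ll i ^+ 2 / rr i + rr i * ee i ^+ 2) - 2 * \sum_i ll i * ee i.
      rewrite mulr_sumr -sumrB; apply: eq_bigr => i _.
      by field; rewrite gt_eqF.
    by lra.
  rewrite mulr_sumr; apply: ler_sum => i _.
  rewrite mulrCA ler_wpM2l ?sqr_ge0 // invfM mulrCA.
  by rewrite ler_peMr ?invr_ge0 ?(ltW (rr0 i)) // ler_pdivlMr // mul1r.
(* The constant needed in [eW]: [coer] contributes [aM], and [g] is at least [am]. *)
pose kap := aM / am.
have kap1 : 1 <= kap by rewrite ler_pdivlMr // mul1r.
have step k : V k.+1 <= expR (4 * kap * th k) * (V k - n k).
  have W0 : 0 <= W k.
    by apply: sumr_ge0 => i _; rewrite divr_ge0 ?sqr_ge0 // mulr_ge0 // ltW.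
  have eW : \sum_i r k i * e k.+1 i ^+ 2 / g k i <= kap * W k.
    have gM i : g k i <= aM by have /andP[] := hg k i.
    have := coer _ _ _ _ (r0 k) (g0 k) gM (hle k.+1).
    rewrite -/(W k) => h.
    rewrite /kap mulrAC ler_pdivlMr // mulr_suml; apply: le_trans h.
    apply: ler_sum => i _; apply: (@le_trans _ _ (r k i * e k.+1 i ^+ 2)).
      rewrite mulrAC ler_pdivrMr // ler_wpM2l //; last by have /andP[] := hg k i.
      by rewrite mulr_ge0 ?sqr_ge0 // ltW.
    by rewrite lerDr divr_ge0 ?sqr_ge0 // ltW.
  have hV : V k.+1 <= (1 + th k) ^+ 3 * (W k + th k * (kap * W k)).
    apply: le_trans (_ : _ <= \sum_i (1 + th k) ^+ 3 *
      ((l k.+1 i - r k i * e k.+1 i) ^+ 2 / (r k i * g k i) +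
       th k * (r k i * e k.+1 i ^+ 2 / g k i))) _.
      by apply: ler_sum => i _; exact: weight_change.
    rewrite -mulr_sumr big_split /= -mulr_sumr.
    by rewrite ler_wpM2l ?exprn_ge0 ?addr_ge0 // lerD2l ler_wpM2l.
  apply: (le_trans hV).
  (* Three factors [1 + th k] from the weights and one factor [1 + kap * th k] from the error term
     are each at most [expR (kap * th k)]; hence the exponent [4 * kap * th k]. *)
  have hx : 1 + kap * th k <= expR (kap * th k) by exact: expR_ge1Dx.
  have hth : 1 + th k <= 1 + kap * th k by rewrite lerD2l ler_peMl.
  have t1 : 0 <= 1 + th k by rewrite addr_ge0.
  have -> : W k + th k * (kap * W k) = (1 + kap * th k) * W k by ring.
  rewrite mulrA; apply: ler_pM => //.
    by rewrite mulr_ge0 ?exprn_ge0 //; exact: le_trans hth.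
  rewrite -mulrA expRM_natl [leRHS]exprSr; apply: ler_pM; rewrite ?exprn_ge0 //.
    exact: le_trans hth.
  by rewrite lerXn2r ?nnegrE ?expR_ge0 //; exact: le_trans hx.
have k40 : 0 <= 4 * kap by rewrite mulr_ge0 //; exact: le_trans kap1.
have [Vb nc] := quasi_fejer k40 V0 n0 th0 thS step.
set M := expR _ * _ in Vb.
have q0 i : (fun k => q k i) @ \oo --> 0.
  apply: (@sqr_cvg0 _ _ (fun k => ((2 - aM) * rm)^-1 * n k)); last first.
    by rewrite -[X in _ --> X](mulr0 ((2 - aM) * rm)^-1); apply: cvgMr.
  move=> k; have a2 : 0 < 2 - aM by rewrite subr_gt0.
  rewrite ler_pdivlMl ?mulr_gt0 // /n -mulrA ler_pM2l //.
  apply: le_trans (ler_sum1 (u := fun i => r k i * q k i ^+ 2) i _).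
    by rewrite ler_wpM2r ?sqr_ge0 //; have /andP[] := hr k i.
  by move=> j; rewrite mulr_ge0 ?sqr_ge0 // ltW.
have d0 i : (fun k => e k.+1 i - e k i) @ \oo --> 0.
  (* Monotonicity reads [\sum_i r d ^ 2 <= - \sum_i r g q d]; completing the
     square bounds [d] by [q]. *)
  apply: (@sqr_cvg0 _ _ (fun k => \sum_i rm^-1 * rM * aM ^+ 2 * (q k i * q k i))).
    move=> k; set d := fun i => e k.+1 i - e k i.
    have hd : \sum_i r k i * d i ^+ 2 <= \sum_i r k i * g k i ^+ 2 * q k i ^+ 2.
      have := hmon k.
      have -> : \sum_i (l k.+1 i - l k i) * (e k.+1 i - e k i) =
        \sum_i r k i * d i ^+ 2 + \sum_i r k i * g k i * q k i * d i.
        rewrite -big_split /=; apply: eq_bigr => j _; rewrite hl /d; ring.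
      have : 0 <= \sum_i r k i * (g k i * q k i + d i) ^+ 2.
        by apply: sumr_ge0 => j _; rewrite mulr_ge0 ?sqr_ge0 // ltW.
      have -> : \sum_i r k i * (g k i * q k i + d i) ^+ 2 =
         \sum_i r k i * g k i ^+ 2 * q k i ^+ 2 + \sum_i r k i * d i ^+ 2
         + 2 * \sum_i r k i * g k i * q k i * d i.
        by rewrite mulr_sumr -!big_split /=; apply: eq_bigr => j _; ring.
      by lra.
    apply: (@le_trans _ _ (rm^-1 * \sum_i r k i * d i ^+ 2)).
      rewrite ler_pdivlMl //.
      apply: le_trans (ler_sum1 (u := fun i => r k i * d i ^+ 2) i _).
        by rewrite ler_wpM2r ?sqr_ge0 //; have /andP[] := hr k i.
      by move=> j; rewrite mulr_ge0 ?sqr_ge0 // ltW.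
    apply: (@le_trans _ _ (rm^-1 * \sum_i r k i * g k i ^+ 2 * q k i ^+ 2)).
      by rewrite ler_wpM2l // invr_ge0 ltW.
    rewrite mulr_sumr; apply: ler_sum => j _.
    rewrite (_ : rm^-1 * rM * _ * _ = rm^-1 * (rM * aM ^+ 2 * q k j ^+ 2)); last by ring.
    rewrite ler_wpM2l ?invr_ge0 ?(ltW rm0) // ler_wpM2r ?sqr_ge0 //.
    have /andP[_ rj] := hr k j; have /andP[_ gj] := hg k j.
    apply: ler_pM => //; [exact: ltW|exact: sqr_ge0|].
    by rewrite lerXn2r ?nnegrE // ltW.
  apply: sum_cvg0 => j.
  rewrite -[X in _ --> X](mulr0 (rm^-1 * rM * aM ^+ 2)); apply: cvgMr.
  by rewrite -[X in _ --> X](mulr0 0); apply: cvgM.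
split=> //.
have lb k i : l k i ^+ 2 / r k i + r k i * e k i ^+ 2 <= aM * M.
  apply: le_trans (_ : _ <= aM * V k) _; last by rewrite ler_wpM2l // ltW.
  have gM j : g k j <= aM by have /andP[] := hg k j.
  apply: le_trans (coer _ _ _ _ (r0 k) (g0 k) gM (hle k)).
  apply: (ler_sum1 (u := fun i => l k i ^+ 2 / r k i + r k i * e k i ^+ 2)) => j.
  by apply: addr_ge0; [apply: divr_ge0|apply: mulr_ge0]; rewrite ?sqr_ge0 // ltW.
have aMM : 0 <= aM * M by rewrite mulr_ge0 ?(ltW aM0) //; exact: le_trans (V0 0%N) (Vb _).
(* The two bounds come from [r * e ^+ 2 <= aM * M] and [l ^+ 2 / r <= aM * M], using [rm <= r] in
   the first and [r <= rM] in the second. *)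
exists (Num.max (1 + rm^-1 * (aM * M)) (1 + rM * (aM * M))) => k i.
have /andP[rl ru] := hr k i.
have l0 : 0 <= l k i ^+ 2 / r k i by rewrite divr_ge0 ?sqr_ge0 // ltW.
have e0 : 0 <= r k i * e k i ^+ 2 by rewrite mulr_ge0 ?sqr_ge0 // ltW.
have h := lb k i.
split; rewrite le_max; apply/orP; [left|right]; apply: norm_le_sqr_bound.
  rewrite ler_pdivlMl //; apply: le_trans (_ : _ <= r k i * e k i ^+ 2) _; last lra.
  by rewrite ler_wpM2r ?sqr_ge0.
apply: le_trans (_ : _ <= r k i * (aM * M)) _; last by rewrite ler_wpM2r.
by rewrite mulrC -ler_pdivrMr //; lra.
Qed.

(** * Optimality conditions at the saddle point and at one step *)

(** A nonzero kernel vector would have a vanishing quadratic form. *)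
Lemma pdmx_unit (R : realType) (n : nat) (M : 'M[R]_n) : pdmx M -> M \in unitmx.
Proof.
move=> [_ Mpos]; apply: contraT; rewrite -row_free_unit -kermx_eq0.
move=> /rowV0Pn[v /sub_kermxP vM v0].
have := Mpos v^T; rewrite trmx_eq0 v0 => /(_ isT).
by rewrite /wnorm2 trmxK vM mul0mx mxE ltxx.
Qed.

(** Freezing one primal variable at its saddle value isolates the subgradient inequality for the
    other function. *)
Lemma saddle_point_kkt (R : realType) (p n m : nat)
    (A : 'M[R]_(p, n)) (B : 'M[R]_(p, m)) (c : 'cV[R]_p)
    (f : 'cV[R]_n -> \bar R) (g : 'cV[R]_m -> \bar R) xs zs lams :
  proper_fun f -> proper_fun g -> saddle_point A B c f g xs zs lams ->
  [/\ f xs \is a fin_num, g zs \is a fin_num, A *m xs + B *m zs = c,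
      forall x, f x \is a fin_num ->
        fine (f xs) <= fine (f x) + dotv lams (A *m (x - xs)) &
      forall z, g z \is a fin_num ->
        fine (g zs) <= fine (g z) + dotv lams (B *m (z - zs))].
Proof.
move=> [fN [x0 fx0]] [gN [z0 gz0]] sad.
(* The saddle value is at most the Lagrangian at a point where both [f] and [g] are finite. *)
have fgfin : f xs \is a fin_num /\ g zs \is a fin_num.
  have [_] := sad x0 z0 0; rewrite /lagrangian !fin_numE.
  move: (fN xs) (gN zs) (fN x0) (gN z0) fx0 gz0.
  by case: (f xs) => [a||]; case: (g zs) => [b||]; case: (f x0); case: (g z0).
case: fgfin => fx gz.
have feas : A *m xs + B *m zs = c.
  apply/eqP; rewrite -subr_eq0; apply/eqP; apply: dotv_eq0.
  set r := (_ - c).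
  (* Moving the multiplier by the residual [r] itself turns the left saddle inequality into
     [dotv r r <= 0]. *)
  have [+ _] := sad x0 z0 (lams + r); rewrite /lagrangian -/r.
  rewrite -(fineK fx) -(fineK gz) -!EFinD lee_fin dotvDl; lra.
split=> // [x hx|z hz].
- have [_] := sad x zs 0; rewrite /lagrangian.
  rewrite -(fineK fx) -(fineK gz) -(fineK hx) -!EFinD lee_fin /= mulmxBr.
  rewrite !dotv_lin; lra.
- have [_] := sad xs z 0; rewrite /lagrangian.
  rewrite -(fineK fx) -(fineK gz) -(fineK hz) -!EFinD lee_fin /= mulmxBr.
  rewrite !dotv_lin; lra.
Qed.

(** The gradient of each penalty, before the transpose of [A] or [B] is applied, is a multiplier: an
    intermediate one for the x-update, and exactly the updated [lam'] for the z-update. *)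
Lemma radmm_step_optimality (R : realType) (p n m : nat)
    (A : 'M[R]_(p, n)) (B : 'M[R]_(p, m)) (c : 'cV[R]_p)
    (f : 'cV[R]_n -> \bar R) (g : 'cV[R]_m -> \bar R)
    (Rk Gk : 'M[R]_p) z lam x' xt' z' lam' :
  closed_proper_convex f -> closed_proper_convex g -> pdmx Rk ->
  radmm_step A B c f g Rk Gk z lam x' xt' z' lam' ->
  [/\ f x' \is a fin_num, g z' \is a fin_num,
      lam' = lam + Rk *m (Gk *m (A *m x' + B *m z - c) + B *m (z' - z)),
      forall y, f y \is a fin_num -> fine (f x') <= fine (f y) +
        dotv (lam + Rk *m (A *m x' + B *m z - c)) (A *m (y - x')) &
      forall w, g w \is a fin_num ->
        fine (g z') <= fine (g w) + dotv lam' (B *m (w - z'))].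
Proof.
move=> [_ pf cf] [_ pg cg] pR [hx ext hz elam].
have uR := pdmx_unit pR; have sR := pR.1.
have Rinv v : Rk *m (v + invmx Rk *m lam) = lam + Rk *m v.
  by rewrite mulmxDr mulmxA mulmxV // mul1mx addrC.
split.
- exact: proper_argmin_fin pf hx.
- exact: proper_argmin_fin pg hz.
- rewrite elam ext; congr (_ + _ *m _).
  rewrite -mulmxA mulmxBl mul1mx !mulmxDr !mulmxN.
  move: (Gk *m (A *m x')) (Gk *m (B *m z)) (Gk *m c) (B *m z) (B *m z') => a b d u v.
  by apply/matrixP => i j; rewrite !mxE; ring.
- move=> y hy; rewrite -Rinv.
  apply: (argmin_quadratic_subgradient pf cf sR _ hx hy) => u v.
  by rewrite mulmxBr; apply/matrixP => i j; rewrite !mxE; ring.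
- move=> w hw; rewrite elam -Rinv.
  apply: (argmin_quadratic_subgradient pg cg sR _ hz hw) => u v.
  by rewrite mulmxBr; apply/matrixP => i j; rewrite !mxE; ring.
Qed.

(** Since [1 + lo / (1 - lo)] is the inverse of [1 - lo], the lower bound on [b] inverts to
    [a <= (1 + t) * b]; this explains the quotient in [theta]. *)
Lemma theta_diag_variation (R : realFieldType) (lo hi a b : R) :
  0 <= lo -> lo < 1 -> 0 <= hi -> 0 < a -> (1 - lo) * a <= b -> b <= (1 + hi) * a ->
  let t := Num.max (lo / (1 - lo)) hi in
  [/\ 0 <= t, `|b - a| <= t * a & a <= (1 + t) * b].
Proof.
move=> lo0 lo1 hi0 a0 hl hu t.
have d0 : 0 < 1 - lo by rewrite subr_gt0.
have tl : lo / (1 - lo) <= t by rewrite le_max lexx.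
have th : hi <= t by rewrite le_max lexx orbT.
have tlo : lo <= t.
  apply: le_trans tl; rewrite ler_pdivlMr //; nra.
split; first exact: le_trans th.
  by rewrite ler_norml; apply/andP; split; nra.
have t1 : 1 <= (1 + t) * (1 - lo).
  by move: tl; rewrite ler_pdivrMr //; lra.
have b0 : 0 <= b by apply: le_trans hl; rewrite mulr_ge0 ?ltW.
have -> : (1 + t) * b = (1 + t) * (b - (1 - lo) * a) + (1 + t) * (1 - lo) * a by ring.
have : 0 <= (1 + t) * (b - (1 - lo) * a).
  by rewrite mulr_ge0 // ?subr_ge0 //; lra.
have : 0 <= ((1 + t) * (1 - lo) - 1) * a by rewrite mulr_ge0 ?subr_ge0 // ltW.
lra.
Qed.

(** A restricted form of [mxE] that opens the sum and leaves matrix products inside it folded. *)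
Lemma addmxE (V : zmodType) (m n : nat) (A B : 'M[V]_(m, n)) i j :
  (A + B) i j = A i j + B i j.
Proof. by rewrite mxE. Qed.

Lemma submxE (V : zmodType) (m n : nat) (A B : 'M[V]_(m, n)) i j :
  (A - B) i j = A i j - B i j.
Proof. by rewrite 2!mxE. Qed.

(** * Convergence of the residuals and of the objective values *)

Theorem theorem1 (R : realType) (p n m : nat)
    (A : 'M[R]_(p, n)) (B : 'M[R]_(p, m)) (c : 'cV[R]_p)
    (f : 'cV[R]_n -> \bar R) (g : 'cV[R]_m -> \bar R)
    (hf : closed_proper_convex f) (hg : closed_proper_convex g)
    (xs : 'cV[R]_n) (zs : 'cV[R]_m) (lams : 'cV[R]_p)
    (hsaddle : saddle_point A B c f g xs zs lams)
    (Rk Gk : nat -> 'M[R]_p)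
    (hRk : forall k, is_diag_mx (Rk k) /\ pdmx (Rk k))
    (hGk : forall k, is_diag_mx (Gk k) /\ pdmx (Gk k))
    (rho_min rho_max alpha_min alpha_max : R)
    (hrho : 0 < rho_min /\ rho_min <= rho_max)
    (halpha : [/\ 0 < alpha_min, alpha_min <= alpha_max & alpha_max < 2])
    (hRbnd : forall k,
       loewner_le rho_min%:M (Rk k) /\ loewner_le (Rk k) rho_max%:M)
    (hGbnd : forall k,
       loewner_le alpha_min%:M (Gk k) /\ loewner_le (Gk k) alpha_max%:M)
    (eta_lo eta_hi xi_lo xi_hi : nat -> R)
    (heta : forall k, [/\ 0 <= eta_lo k, eta_lo k < 1 & 0 <= eta_hi k])
    (hxi : forall k, [/\ 0 <= xi_lo k, xi_lo k < 1 & 0 <= xi_hi k])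
    (hRvar : forall k,
       loewner_le ((1 - eta_lo k) *: Rk k) (Rk k.+1) /\
       loewner_le (Rk k.+1) ((1 + eta_hi k) *: Rk k))
    (hGvar : forall k,
       loewner_le ((1 - xi_lo k) *: Gk k) (Gk k.+1) /\
       loewner_le (Gk k.+1) ((1 + xi_hi k) *: Gk k))
    (hsum : (\sum_(0 <= k <oo)
       (theta (eta_lo k) (eta_hi k) + theta (xi_lo k) (xi_hi k))%:E < +oo)%E)
    (x : nat -> 'cV[R]_n) (xt : nat -> 'cV[R]_p)
    (z : nat -> 'cV[R]_m) (lam : nat -> 'cV[R]_p)
    (hiter : forall k, radmm_step A B c f g (Rk k) (Gk k) (z k) (lam k)
                         (x k.+1) (xt k.+1) (z k.+1) (lam k.+1)) :
  [/\ (fun k => A *m x k.+1 + B *m z k.+1 - c) @ \oo --> (0 : 'cV[R]_p),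
      (fun k => A^T *m Rk k *m B *m (z k.+1 - z k)) @ \oo --> (0 : 'cV[R]_n) &
      (fun k => f (x k) + g (z k))%E @ \oo --> (f xs + g zs)%E].
Proof.
have [_ pf cf] := hf; have [_ pg cg] := hg.
have [fxs gzs feas Kf Kg] := saddle_point_kkt pf pg hsaddle.
have opt k := radmm_step_optimality hf hg (hRk k).2 (hiter k).
have dR k : is_diag_mx (Rk k) := (hRk k).1.
have dG k : is_diag_mx (Gk k) := (hGk k).1.
case: hrho => rm0 rmM; case: halpha => am0 amM aM2.
(* This residual pairs the new [x] with the old [z]; the primal residual is [Q k + D k]. *)
pose Q k := A *m x k.+1 + B *m z k - c.
pose E k := B *m (z k - zs).
pose L k := lam k - lams.
pose D k := B *m (z k.+1 - z k).
have DE k : D k = E k.+1 - E k.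
  by rewrite /D /E -mulmxBr; congr (_ *m _); apply/matrixP => i j; rewrite !mxE; ring.
have AX k : A *m (x k.+1 - xs) = Q k - E k.
  rewrite /Q /E -feas !mulmxBr; apply/matrixP => i j; rewrite !mxE; ring.
(* Monotonicity of the subdifferential: the optimality and saddle inequalities are added, and the
   function values cancel. [hg1] does the same for [g], and [hmon] uses two successive z-updates. *)
have hf1 k : dotv (L k + Rk k *m Q k) (Q k - E k) <= 0.
  have [fx _ _ hx _] := opt k.
  have := hx _ fxs; have := Kf _ fx; rewrite -/(Q k) -AX -(opprB (x _)) mulmxN.
  rewrite /L !dotv_lin; lra.
have hg1 k : dotv (L k.+1) (E k.+1) <= 0.
  have [_ gz _ _ hz] := opt k.
  have := hz _ gzs; have := Kg _ gz; rewrite -(opprB (z _)) mulmxN -/(E k.+1).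
  rewrite /L !dotv_lin; lra.
have hmon k : dotv (L k.+2 - L k.+1) (E k.+2 - E k.+1) <= 0.
  have [_ gz _ _ hz] := opt k; have [_ gz' _ _ hz'] := opt k.+1.
  have := hz _ gz'; have := hz' _ gz; rewrite -(opprB (z k.+2)) mulmxN -/(D k.+1) -DE.
  rewrite /L !dotv_lin; lra.
have hL k : L k.+1 = L k + Rk k *m (Gk k *m Q k + D k).
  by have [_ _ e _ _] := opt k; rewrite /L {1}e addrAC.
pose r k i := Rk k i i; pose g' k i := Gk k i i.
pose th k := theta (eta_lo k) (eta_hi k) + theta (xi_lo k) (xi_hi k).
have rb k i : rho_min <= r k i <= rho_max.
  have [/(loewner_le_diag i) + /(loewner_le_diag i)] := hRbnd k.
  by rewrite !mxE eqxx !mulr1n => -> ->.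
have gb k i : alpha_min <= g' k i <= alpha_max.
  have [/(loewner_le_diag i) + /(loewner_le_diag i)] := hGbnd k.
  by rewrite !mxE eqxx !mulr1n => -> ->.
have r0 k i : 0 < r k i by have /andP[h _] := rb k i; exact: lt_le_trans h.
have g0 k i : 0 < g' k i by have /andP[h _] := gb k i; exact: lt_le_trans h.
have thR k i : [/\ 0 <= theta (eta_lo k) (eta_hi k),
    `|r k.+1 i - r k i| <= theta (eta_lo k) (eta_hi k) * r k i &
    r k i <= (1 + theta (eta_lo k) (eta_hi k)) * r k.+1 i].
  have [a b d] := heta k; apply: theta_diag_variation => //.
  - by have [/(loewner_le_diag i) + _] := hRvar k; rewrite mxE.
  - by have [_ /(loewner_le_diag i)] := hRvar k; rewrite mxE.
have thG k i : [/\ 0 <= theta (xi_lo k) (xi_hi k),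
    `|g' k.+1 i - g' k i| <= theta (xi_lo k) (xi_hi k) * g' k i &
    g' k i <= (1 + theta (xi_lo k) (xi_hi k)) * g' k.+1 i].
  have [a b d] := hxi k; apply: theta_diag_variation => //.
  - by have [/(loewner_le_diag i) + _] := hGvar k; rewrite mxE.
  - by have [_ /(loewner_le_diag i)] := hGvar k; rewrite mxE.
have tR0 k : 0 <= theta (eta_lo k) (eta_hi k).
  by have [_ _ h] := heta k; rewrite le_max h orbT.
have tG0 k : 0 <= theta (xi_lo k) (xi_hi k).
  by have [_ _ h] := hxi k; rewrite le_max h orbT.
have th0 k : 0 <= th k by exact: addr_ge0.
(* The sum starts at [th 1] because of the index shift below; the dropped term [th 0] is
   nonnegative. *)
have [S hS] : exists S, forall N, \sum_(0 <= k < N) th k.+1 <= S.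
  exists (fine (\sum_(0 <= k <oo) (th k)%:E)%E) => N.
  have t0 k : (0 <= k)%N -> true -> (0 <= (th k)%:E)%E by rewrite lee_fin.
  rewrite -lee_fin fineK; last first.
    by rewrite ge0_fin_numE //; apply: nneseries_ge0.
  apply: le_trans (nneseries_lim_ge N.+1 t0).
  by rewrite sumEFin lee_fin big_nat_recl //= lerDr.
(* Indices are shifted by one: [z 0] and [lam 0] are arbitrary, so the optimality inequality for [g]
   holds only from the first z-update on. *)
pose e k i := E k.+1 i 0; pose l k i := L k.+1 i 0; pose q k i := Q k.+1 i 0.
have hl k i : l k.+1 i =
    l k i + r k.+1 i * (g' k.+1 i * q k i + (e k.+1 i - e k i)).
  rewrite /l hL DE addmxE (diag_mulmxE _ _ (dR _)).
  by rewrite (addmxE (Gk _ *m _)) (diag_mulmxE _ _ (dG _)) (submxE (E _)).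
have [q0 d0 [C hC]] : [/\ forall i, (fun k => q k i) @ \oo --> 0,
      forall i, (fun k => e k.+1 i - e k i) @ \oo --> 0 &
      exists C, forall k i, `|e k i| <= C /\ `|l k i| <= C].
  apply: (@relaxed_splitting_cvg _ _ (fun k => r k.+1) (fun k => g' k.+1) e l q
            (fun k => th k.+1) S rho_min rho_max alpha_min alpha_max) => //.
  - by move=> k i; have [_ h _] := thR k.+1 i; apply: le_trans h _;
      rewrite ler_wpM2r ?(ltW (r0 _ _)) // lerDl.
  - move=> k i; have [_ _ h] := thR k.+1 i; apply: le_trans h _.
    by rewrite ler_wpM2r ?(ltW (r0 _ _)) // lerD2l lerDl.
  - move=> k i; have [_ _ h] := thG k.+1 i; apply: le_trans h _.
    by rewrite ler_wpM2r ?(ltW (g0 _ _)) // lerD2l lerDr.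
  (* In the sum of these two inequalities the products of [L] with [E] cancel, which leaves
     [L - R E] paired with [Q]. *)
  - move=> k; rewrite -subr_le0 opprK.
    have := lerD (hf1 k.+1) (hg1 k); rewrite addr0; congr (_ <= _).
    rewrite !dotvE -!big_split /=; apply: eq_bigr => i _.
    by rewrite addmxE (submxE (Q _)) (diag_mulmxE _ _ (dR _)) /l /e /q /r; ring.
  - by move=> k; have := hg1 k; rewrite dotvE.
  - move=> k; have := hmon k; rewrite dotvE; congr (_ <= _).
    by apply: eq_bigr => i _; rewrite (submxE (L _)) (submxE (E _)).
have re k i : `|r k.+1 i| <= rho_max.
  by have /andP[_ h] := rb k.+1 i; rewrite gtr0_norm.
have ge k i : `|g' k.+1 i| <= alpha_max.
  by have /andP[_ h] := gb k.+1 i; rewrite gtr0_norm.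
have eb k i : `|e k i| <= C by have [] := hC k i.
have lb k i : `|lams i 0 + l k i| <= `|lams i 0| + C.
  by apply: le_trans (ler_normD _ _) _; rewrite lerD2l; have [] := hC k i.
pose d k i := e k.+1 i - e k i.
have qd0 i : (fun k => q k i + d k i) @ \oo --> 0.
  by rewrite -[X in _ --> X](addr0 0); apply: cvgD; [exact: q0|exact: d0].
have resE k i : (A *m x k.+2 + B *m z k.+2 - c) i 0 = q k i + d k i.
  rewrite (_ : _ - c = Q k.+1 + D k.+1); first by rewrite DE addmxE (submxE (E _)).
  by rewrite /Q /D mulmxBr; apply/matrixP => a b; rewrite !mxE; ring.
split.
- rewrite -(cvg_shiftS (fun k => A *m x k.+1 + B *m z k.+1 - c)) /=.
  apply: mx_cvg => i j; rewrite (ord1 j) mxE.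
  by rewrite (_ : (fun k => _) = fun k => q k i + d k i); [exact: qd0|exact/funext].
- rewrite -(cvg_shiftS (fun k => A^T *m Rk k *m B *m (z k.+1 - z k))) /=.
  apply: mx_cvg => i j; rewrite (ord1 j) mxE.
  have -> : (fun k => (A^T *m Rk k.+1 *m B *m (z k.+2 - z k.+1)) i 0) =
            (fun k => \sum_h A h i * (r k.+1 h * d k h)).
    apply/funext => k; rewrite -!mulmxA -/(D k.+1) DE mxE; apply: eq_bigr => h _.
    by rewrite [X in X * _]mxE (diag_mulmxE _ _ (dR _)) (submxE (E _)).
  apply: sum_cvg0 => h; rewrite -[X in _ --> X](mulr0 (A h i)); apply: cvgMr.
  exact: bounded_mul_cvg0 (fun k => re k h) (d0 h).
(* The initial value may be [+oo]; two shifts reach the indices of [q], [e] and [l], where all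
   values are finite. *)
- rewrite -(cvg_shiftS (fun k => f (x k) + g (z k))%E) /=.
  rewrite -(cvg_shiftS (fun k => f (x k.+1) + g (z k.+1))%E) /=.
  rewrite -(fineK fxs) -(fineK gzs) -EFinD.
  apply/fine_cvgP; split.
    by apply: nearW => k; have [fx gz _ _ _] := opt k.+1; rewrite fin_numD fx gz.
  (* The saddle inequalities bound the objective gap from below by [- lo k], where [lo] pairs [lams]
     with the primal residual. *)
  pose lo k := \sum_i lams i 0 * (q k i + d k i).
  (* The optimality inequalities tested at [xs] and [zs] give this upper bound on the gap, regrouped
     so that every term is a bounded factor times a null sequence built from [q] and [d]. *)
  pose hi k := \sum_i (- ((lams i 0 + l k i) * (q k i + d k i))
     - r k.+1 i * (q k i * (q k i + d k i))
     + e k.+1 i * (r k.+1 i * (q k i - d k i - g' k.+1 i * q k i))).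
  have lo0 : lo @ \oo --> 0.
    apply: sum_cvg0 => i; rewrite -[X in _ --> X](mulr0 (lams i 0)).
    by apply: cvgMr; exact: qd0.
  have hi0 : hi @ \oo --> 0.
    apply: sum_cvg0 => i; rewrite -[X in _ --> X](_ : - 0 - 0 + 0 = 0); last by ring.
    apply: cvgD; [apply: cvgB; [apply: cvgN|]|].
    + exact: bounded_mul_cvg0 (fun k => lb k i) (qd0 i).
    + apply: bounded_mul_cvg0 (fun k => re k i) _.
      by rewrite -[X in _ --> X](mulr0 0); apply: cvgM; [exact: q0|exact: qd0].
    + apply: bounded_mul_cvg0 (fun k => eb k.+1 i) _.
      apply: bounded_mul_cvg0 (fun k => re k i) _.
      rewrite -[X in _ --> X](_ : 0 - 0 - 0 = 0); last by ring.
      apply: cvgB; [apply: cvgB; [exact: q0|exact: d0]|].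
      exact: bounded_mul_cvg0 (fun k => ge k i) (q0 i).
  apply: (@squeeze_cvgr _ _ _ _ (fun k => fine (f xs) + fine (g zs) - lo k)
            (fun k => fine (f xs) + fine (g zs) + hi k)); last 2 first.
  + rewrite -[X in _ --> X]subr0; apply: cvgB => //; exact: cvg_cst.
  + rewrite -[X in _ --> X]addr0; apply: cvgD => //; exact: cvg_cst.
  apply: nearW => k; have [fx gz _ hx hz] := opt k.+1.
  rewrite /= fineD //; apply/andP; split.
    have -> : lo k = dotv lams (A *m (x k.+2 - xs)) + dotv lams (B *m (z k.+2 - zs)).
      rewrite -dotvDr dotvE /lo; apply: eq_bigr => i _; rewrite -resE; congr (_ * _).
      congr (fun_of_matrix _ i 0).
      by rewrite -feas !mulmxBr; apply/matrixP => a b; rewrite !mxE; ring.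
    have := Kf _ fx; have := Kg _ gz; lra.
  have := hx _ fxs; have := hz _ gzs.
  suff -> : hi k = dotv (lam k.+1 + Rk k.+1 *m Q k.+1) (A *m (xs - x k.+2)) +
                   dotv (lam k.+2) (B *m (zs - z k.+2)) by rewrite /Q; lra.
  rewrite /hi -(opprB (x _)) -(opprB (z _)) !mulmxN AX -/(E k.+2) !dotvNr !dotvE.
  rewrite -!sumrN -big_split /=; apply: eq_bigr => i _.
  rewrite addmxE (submxE (Q _)) (diag_mulmxE _ _ (dR _)).
  have el j : lam j.+1 i 0 = lams i 0 + l j i by rewrite /l /L submxE; ring.
  by rewrite !el hl /d -/(e k i) -/(e k.+1 i) -/(q k i) -/(r k.+1 i); ring.
Qed.
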